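(* Let $X$ and $Y$ be metric spaces such that $\mathrm{trasdim}\,X<\infty$ and $\mathrm{trasdim}\,Y<\infty$. Then $\mathrm{trasdim}(X\times Y)<\infty$, where $X\times Y$ carries the product metric $d((x,y),(x',y'))=d_X(x,x')+d_Y(y,y')$.
   Context: $\mathbb{N}=\{1,2,3,\dots\}$. Metrics take finite values. $\omega^*$ is the set of all finite sequences of natural numbers, including the empty sequence $\emptyset$; $s(i)$ is the $i$-th term of $s$, and $|s|$ its length. A tree is a subset of $\omega^*$ closed under taking prefixes; it is well founded if it has no infinite branch. For $s$ in a well founded tree $T$, $\mathrm{rank}_T(s)=0$ if $s$ is a leaf (no proper extension of $s$ is in $T$), and otherwise $\mathrm{rank}_T(s)=\sup\{\mathrm{rank}_T(s^\wedge n)+1 : n\in\mathbb{N},\ s^\wedge n\in T\}$, where $s^\wedge n$ is $s$ extended by one term $n$. $\mathrm{rank}\,T=\mathrm{rank}_T(\emptyset)$; $\mathrm{rank}\,T=\infty$ (greater than every ordinal) if $T$ is not well founded; the empty tree has rank $0$. A family $\mathcal{A}$ of subsets of a metric space is uniformly bounded if there is $C\ge 0$ with $\mathrm{diam}\,A\le C$ for all $A\in\mathcal{A}$; it is $r$-disjoint ($r>0$) if $d(A_1,A_2)=\inf\{d(a_1,a_2):a_i\in A_i\}\ge r$ for all distinct $A_1,A_2\in\mathcal{A}$. For $s\in\omega^*$, an $s$-cover of $X$ is a sequence $(\mathcal{V}_1,\dots,\mathcal{V}_{|s|})$ of families of subsets of $X$ such that each $\mathcal{V}_i$ is $s(i)$-disjoint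 and $\bigcup_i\mathcal{V}_i$ is uniformly bounded and covers $X$. $T(X,d)$ is the tree of all $s\in\omega^*$ for which $X$ has no $s$-cover, and $\mathrm{trasdim}\,X=\mathrm{rank}\,T(X,d)$ (transfinite asymptotic dimension; $\mathrm{trasdim}\,X<\infty$ is equivalent to asymptotic property C). *)

(* Defs.v *)
From HB Require Import structures.
From mathcomp Require Import all_boot all_order all_algebra.
From mathcomp Require Import all_classical all_reals all_analysis.

Set Implicit Arguments.
Unset Strict Implicit.
Unset Printing Implicit Defensive.
Import Order.TTheory GRing.Theory Num.Theory.

Local Open Scope classical_set_scope.
Local Open Scope ring_scope.

(* Ordinals are presented as well-founded trees: [osup f] denotes
   sup {f i + 1 | i : K}, so that [osup] over an empty type is 0.  Distinct
   presentations may denote the same ordinal; the order [ord_le] is the one of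
   the denoted ordinals. *)
Inductive ord : Type := osup (K : Type) (f : K -> ord).

Fixpoint ord_le (a b : ord) {struct a} : Prop :=
  let: osup K f := a in let: osup L g := b in
  forall i : K, exists j : L, ord_le (f i) (g j).

Definition ord_lt (a b : ord) : Prop :=
  let: osup L g := b in exists j : L, ord_le a (g j).

Inductive xord : Type := Ord of ord | Infinity.

Definition xord_lt (x y : xord) : Prop :=
  match x, y with
  | Ord a, Ord b => ord_lt a b
  | Ord _, Infinity => True
  | Infinity, _ => False
  end.

Declare Scope xord_scope.
Delimit Scope xord_scope with xord.
Notation "x < y" := (xord_lt x y) : xord_scope.

Notation pnat := {n : nat | (0 < n)%N}.

Record tree : Type := Tree {
  tree_mem :> seq pnat -> Prop ;
  tree_prefix : forall s t : seq pnat, prefix s t -> tree_mem t -> tree_mem s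
}.

Definition wf_tree (T : tree) : Prop :=
  ~ exists b : nat -> pnat, forall k : nat, T (mkseq b k).

Definition child (T : tree) (t s : seq pnat) : Prop :=
  T t /\ exists n : pnat, t = rcons s n.

Lemma wf_tree_Acc (T : tree) : wf_tree T -> Acc (child T) [::].
Proof.
move=> wfT; apply: contrapT => nacc.
have next (s : seq pnat) : ~ Acc (child T) s ->
    exists n : pnat, T (rcons s n) /\ ~ Acc (child T) (rcons s n).
  move=> ns; apply: contrapT => no; apply: ns; constructor => t [Tt [n tE]].
  by apply: contrapT => nt; apply: no; exists n; rewrite -tE.
have /choice[g gP] (s : seq pnat) : exists n : pnat, ~ Acc (child T) s ->
    T (rcons s n) /\ ~ Acc (child T) (rcons s n).
  have [/next[n nP]|ns] := pselect (~ Acc (child T) s); first by exists n.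
  by exists (exist _ 1%N isT).
pose f k := iter k (fun s => rcons s (g s)) [::].
have fP k : ~ Acc (child T) (f k) by elim: k => [//|k IHk]; apply: (gP _ _).2.
have fE k : f k = mkseq (fun i => g (f i)) k.
  by elim: k => [//|k IHk]; rewrite mkseqS -IHk.
apply: wfT; exists (fun i => g (f i)) => k; rewrite -fE.
apply: (tree_prefix (t := f k.+1)); first exact: prefix_rcons.
exact: (gP _ (fP k)).1.
Qed.

(* rank_T(s) = sup {rank_T(s^n) + 1 | n, s^n \in T}, by recursion along [T]; a
   leaf is the case of the empty supremum. *)
Fixpoint node_rank (T : tree) (s : seq pnat) (h : Acc (child T) s) {struct h} :
    ord :=
  osup (fun n : {n : pnat | T (rcons s n)} =>
    node_rank (Acc_inv h (conj (proj2_sig n)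
      (ex_intro (fun m => rcons s (proj1_sig n) = rcons s m) _ erefl)))).

Definition rank (T : tree) : xord :=
  match pselect (wf_tree T) with
  | left wfT => Ord (node_rank (wf_tree_Acc wfT))
  | right _ => Infinity
  end.

Section AsymptoticDimension.
Context {R : realType} (X : metricType R).
Implicit Types (A B : set X) (F : set (set X)).

(* [diam] and [set_dist] are extended real numbers, so that the distance to the
   empty set is +oo; the diameter of the empty set is -oo here. *)
Definition diam A : \bar R :=
  ereal_sup [set (mdist p.1 p.2)%:E | p in A `*` A].

Definition set_dist A B : \bar R :=
  ereal_inf [set (mdist p.1 p.2)%:E | p in A `*` B].

Definition uniformly_bounded F : Prop :=
  exists2 C : R, 0 <= C & forall A, F A -> (diam A <= C%:E)%E.

Definition r_disjoint (r : R) F : Prop :=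
  forall A B, F A -> F B -> A <> B -> (r%:E <= set_dist A B)%E.

Definition is_scover (s : seq pnat) (V : 'I_(size s) -> set (set X)) : Prop :=
  [/\ forall i, r_disjoint (val (tnth (in_tuple s) i))%:R (V i),
      uniformly_bounded (\bigcup_i V i)
    & cover (\bigcup_i V i) id = [set: X]].

Definition no_scover : set (seq pnat) :=
  [set s | ~ exists V : 'I_(size s) -> set (set X), is_scover V].

Lemma no_scover_prefix (s t : seq pnat) :
  prefix s t -> no_scover t -> no_scover s.
Proof.
move=> /prefixP[u ->] nt [V [Vd Vb Vc]]; apply: nt.
pose W (i : 'I_(size (s ++ u))) : set (set X) :=
  if insub (val i) is Some j then V j else set0.
have WV : \bigcup_i W i = \bigcup_i V i.
  apply/seteqP; split => A [i _].
    by rewrite /W; case: insubP => // j _ _ VA; exists j.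
  have iu : (i < size (s ++ u))%N by rewrite size_cat ltn_addr.
  move=> VA; exists (Ordinal iu) => //=; rewrite /W /=.
  by rewrite (insubT (fun k => k < size s)%N (ltn_ord i)) (_ : Sub _ _ = i) //;
    apply: val_inj.
exists W; split; rewrite ?WV // => i; rewrite /W.
case: insubP => [j js jE|_] A B //; move: (Vd j A B).
set x0 := tnth (in_tuple s) j.
by rewrite /x0 !(tnth_nth x0) /= nth_cat -jE (ltn_ord j).
Qed.

Definition scover_tree : tree := Tree no_scover_prefix.

Definition trasdim : xord := rank scover_tree.

End AsymptoticDimension.

(* The product with the sum metric; the canonical structure of [X * Y] carries
   the maximum of the two pseudometrics instead. *)
Definition sum_prod (R : realType) (X Y : metricType R) : Type := (X * Y)%type.

Section SumProduct.
Context {R : realType} (X Y : metricType R).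

Definition sum_dist (p q : sum_prod X Y) : R :=
  mdist p.1 q.1 + mdist p.2 q.2.

Lemma sum_distxx p : sum_dist p p = 0.
Proof. by rewrite /sum_dist !mdistxx addr0. Qed.

Lemma sum_dist_positivity p q : sum_dist p q = 0 -> p = q.
Proof.
move/eqP; rewrite /sum_dist paddr_eq0 ?mdist_ge0 // => /andP[/eqP h1 /eqP h2].
case: p q h1 h2 => [x y] [x' y'] /= h1 h2.
by rewrite (mdist_positivity _ _ h1) (mdist_positivity _ _ h2).
Qed.

Lemma sum_dist_sym p q : sum_dist p q = sum_dist q p.
Proof. by rewrite /sum_dist metric_sym (metric_sym p.2). Qed.

Lemma sum_dist_triangle q p r : sum_dist p r <= sum_dist p q + sum_dist q r.
Proof. by rewrite /sum_dist addrACA lerD // metric_triangle. Qed.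

HB.instance Definition _ := Choice.copy (sum_prod X Y) (X * Y)%type.
HB.instance Definition _ := isMetric.Build R (sum_prod X Y)
  sum_distxx sum_dist_positivity sum_dist_sym sum_dist_triangle.

End SumProduct.

(* Main.v *)
Require Import Defs.
From mathcomp Require Import all_boot all_order all_algebra.
From mathcomp Require Import all_classical all_reals all_analysis.

(* Only asymptotic property C matters: for every sequence [b] of scales some
   finite prefix of [b] admits a cover.  Given [b] on the product, cover X at the
   scales [b n], [b n.+1], ... for each starting index [n]; this uses [K n] of
   them.  Cut [nat] into consecutive blocks, the block starting at [n] having
   length [K n], and cover Y at the scales [c j], where [c j] dominates [b] on the
   [j]-th block.  Multiplying the [j]-th family on Y by the families on X attached
   to the [j]-th block gives families on the product indexed by a prefix of [b]. *)

Set Implicit Arguments.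
Unset Strict Implicit.
Unset Printing Implicit Defensive.
Import Order.TTheory GRing.Theory Num.Theory.
Local Open Scope classical_set_scope.
Local Open Scope ring_scope.

Section PropertyC.
Context {R : realType} (X : metricType R).

(** Families are indexed by all of [nat], with indices from [k] on ignored, and distances are
    bounded point by point; this avoids ordinals depending on [size s] and extended reals. *)
Definition covers_at (b : nat -> Defs.pnat) (k : nat) (V : nat -> set (set X))
    (C : R) : Prop :=
  [/\ 0 <= C,
      forall i A B x y, (i < k)%N -> V i A -> V i B -> A <> B -> A x -> B y ->
        (val (b i))%:R <= mdist x y,
      forall i A x y, (i < k)%N -> V i A -> A x -> A y -> mdist x y <= C
    & forall x, exists i A, [/\ (i < k)%N, V i A & A x]].

Definition propertyC : Prop :=
  forall b : nat -> Defs.pnat, exists k V C, covers_at b k V C.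

Lemma scover_covers_at (b : nat -> Defs.pnat) (k : nat) :
  (exists V : 'I_(size (mkseq b k)) -> set (set X), is_scover V) <->
  (exists V C, covers_at b k V C).
Proof.
have ltk (i : 'I_(size (mkseq b k))) : (i < k)%N.
  by have := ltn_ord i; rewrite [X in (_ < X)%N]size_mkseq.
have scaleE (i : 'I_(size (mkseq b k))) :
    tnth (in_tuple (mkseq b k)) i = b i.
  by rewrite (tnth_nth (b 0)) /= nth_mkseq.
split=> [[V [Vd [C C0 VC] Vc]]|[V [C [C0 Vd VC Vc]]]].
  pose W n := [set A | exists2 i, val i = n & V i A].
  exists W, C; split => //.
  - move=> _ A B x y _ [i <- ViA] [j /val_inj -> ViB] AB Ax By.
    rewrite -scaleE -lee_fin; apply: (le_trans (Vd i A B ViA ViB AB)).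
    by apply: ereal_inf_lbound; exists (x, y).
  - move=> _ A x y _ [i _ ViA] Ax Ay; rewrite -lee_fin.
    apply: (le_trans _ (VC A _)); last by exists i.
    by apply: ereal_sup_ubound; exists (x, y).
  - move=> x; have : cover (\bigcup_i V i) id x by rewrite Vc.
    move=> [A [i _ ViA] Ax]; exists (val i), A.
    by split; [exact: ltk|exists i|].
exists (fun i => V (val i)); split.
- move=> i A B ViA ViB AB; rewrite scaleE.
  apply: le_ereal_inf_tmp => _ [[x y] [/= Ax By] <-]; rewrite lee_fin.
  exact: (Vd i A B).
- exists C => // A [i _ ViA]; apply: ge_ereal_sup => _ [[x y] [/= Ax Ay] <-].
  by rewrite lee_fin; exact: (VC i A).
- rewrite -subTset => x _; have [i [A [ik ViA Ax]]] := Vc x.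
  have ik' : (i < size (mkseq b k))%N by rewrite size_mkseq.
  by exists A => //; exists (Ordinal ik').
Qed.

(** An infinite branch of the tree is exactly a sequence of scales none of whose finite prefixes
    admits a cover. *)
Lemma trasdim_ltInfinity : (trasdim X < Infinity)%xord <-> propertyC.
Proof.
rewrite /trasdim /rank; case: pselect => [wfX|nwfX]; split => //= h.
- move=> b; apply: contrapT => nb; apply: wfX; exists b => k /= bk.
  by apply: nb; exists k; apply/scover_covers_at.
- apply: nwfX => -[b bT]; have [k /scover_covers_at bk] := h b.
  exact: (bT k bk).
Qed.

End PropertyC.

Lemma propertyC_prod (R : realType) (X Y : metricType R) :
  propertyC X -> propertyC Y -> propertyC (sum_prod X Y).
Proof.
move=> CX CY b.
have /choice[K /choice[V /choice[C VP]]] (n : nat) := CX (fun i => b (n + i)%N).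
pose start j := iter j (fun n => n + K n)%N 0%N.
have start_le j l : (j <= l)%N -> (start j <= start l)%N.
  move=> /subnKC <-; elim: (l - j)%N => [|d IHd]; first by rewrite addn0.
  by rewrite addnS; exact: leq_trans IHd (leq_addr _ _).
(* Blocks do not overlap, so all members of one family [W n] below come from the same [j] and
   [i]. *)
have block_inj j l i i' : (i < K (start j))%N -> (i' < K (start l))%N ->
    (start j + i = start l + i')%N -> j = l.
  wlog jl : j l i i' / (j <= l)%N => [wl|].
    move=> iK iK' e; have [jl|lj] := orP (leq_total j l).
      exact: wl jl iK iK' e.
    by symmetry; exact: wl lj iK' iK (esym e).
  move=> iK _ e; apply/eqP; rewrite eqn_leq jl /= leqNgt; apply/negP => lj.
  have := leq_trans (start_le _ _ lj) (leq_addr i' _).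
  by rewrite -e /= leq_add2l leqNgt iK.
(* The sum bounds every scale in the block; the successor keeps it positive when the block is
   empty. *)
pose c j : Defs.pnat :=
  exist (fun n => (0 < n)%N)
    (\sum_(i < K (start j)) val (b (start j + i)%N)).+1 isT.
have b_le_c j i : (i < K (start j))%N ->
    (val (b (start j + i)%N) <= val (c j))%N.
  by move=> iK; rewrite /= (bigD1 (Ordinal iK)) //= ltnW // ltnS leq_addr.
have [m [U [D [D0 Ud UD Uc]]]] := CY c.
pose W n := [set P : set (sum_prod X Y) | exists j i,
  [/\ (j < m)%N, (i < K (start j))%N, n = (start j + i)%N
    & exists A B, [/\ V (start j) i A, U j B & P = A `*` B]]].
(* The first [m] blocks fill exactly the indices below [start m]; the sum bounds [C (start j)] for
   all [j < m] at once. *)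
exists (start m), W, (\sum_(j < m) C (start j) + D).
have C0 n : 0 <= C n by case: (VP n).
split.
- by rewrite addr_ge0 // sumr_ge0.
- move=> n P Q [x y] [x' y'] _ [j [i [jm iK -> [A [B [VA UB ->]]]]]].
  move=> [j' [i' [_ iK' e [A' [B' [VA' UB' ->]]]]]] PQ [/= Ax By] [/= Ax' By'].
  have jj' := block_inj _ _ _ _ iK iK' e; subst j'.
  move/addnI: e => ii'; subst i'.
  have [_ Vd _ _] := VP (start j).
  rewrite [mdist _ _]/(mdist x x' + mdist y y').
  (* Distinct products differ in a factor: if [A] and [A'] differ, X alone gives the distance;
     otherwise Y does, through [c j]. *)
  have [AA'|AA'] := pselect (A = A'); last first.
    apply: (le_trans (Vd i A A' x x' iK VA VA' AA' Ax Ax')).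
    by rewrite lerDl mdist_ge0.
  have BB' : B <> B' by move=> BB'; apply: PQ; rewrite AA' BB'.
  apply: (@le_trans _ _ (val (c j))%:R); first by rewrite ler_nat b_le_c.
  apply: (le_trans (Ud j B B' y y' jm UB UB' BB' By By')).
  by rewrite lerDr mdist_ge0.
- move=> n P [x y] [x' y'] _ [j [i [jm iK _ [A [B [VA UB ->]]]]]].
  move=> [/= Ax By] [/= Ax' By'].
  have [_ _ VC _] := VP (start j).
  rewrite [mdist _ _]/(mdist x x' + mdist y y') lerD //; last exact: (UD j B).
  apply: (le_trans (VC i A x x' iK VA Ax Ax')).
  by rewrite (bigD1 (Ordinal jm)) //= lerDl sumr_ge0.
(* The point [y] selects the block [j]; only then is [x] covered within that block. *)
- move=> [x y]; have [j [B [jm UB By]]] := Uc y.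
  have [_ _ _ /(_ x)[i [A [iK VA Ax]]]] := VP (start j).
  exists (start j + i)%N, (A `*` B); split => //.
    by apply: leq_trans (start_le _ _ jm); rewrite /= ltn_add2l.
  by exists j, i; split => //; exists A, B.
Qed.

Theorem theorem9 (R : realType) (X Y : metricType R) :
  (trasdim X < Infinity)%xord ->
  (trasdim Y < Infinity)%xord ->
  (trasdim (sum_prod X Y) < Infinity)%xord.
Proof.
by rewrite !trasdim_ltInfinity; exact: propertyC_prod.
Qed.
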